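(* Define $u:\mathbb{R}\to\mathbb{R}$ by $$u(x)=\begin{cases}\frac56,&0<x<2,\\ \frac53,&2<x<4,\\ \frac76,&4<x<6,\\ \frac13,&6<x<8,\\ 0,&\text{otherwise,}\end{cases}$$ and let $u^*$ be its symmetric decreasing rearrangement, namely $$u^*(x)=\begin{cases}\frac53,&|x|<1,\\ \frac76,&1<|x|<2,\\ \frac56,&2<|x|<3,\\ \frac13,&3<|x|<4,\\ 0,&|x|>4.\end{cases}$$ Then for every real $p>1$, $$I_{1,p}(u^* )-I_{1,p}(u)=\frac{2}{p(p-1)}\left(2^{1-p}-2\cdot 3^{1-p}+2\cdot 5^{1-p}-6^{1-p}\right)>0.$$ At $p=1$, $$I_{1,1}(u^* )-I_{1,1}(u)=2\log\frac{27}{25}>0.$$ In particular, when $p=2$, $$I_{1,2}(u)=\frac56,\qquad I_{1,2}(u^* )=\frac{9}{10},\qquad I_{1,2}(u^* )-I_{1,2}(u)=\frac1{15}.$$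
   Context: For real $p\ge 1$ and a measurable function $w:\mathbb{R}\to\mathbb{R}$, the (one-dimensional, threshold $\delta=1$) nonlocal threshold functional is $$I_{1,p}(w):=\iint_{\{(x,y)\in\mathbb{R}^2:\ |w(x)-w(y)|>1\}}\frac{1}{|x-y|^{1+p}}\,dx\,dy,$$ with respect to Lebesgue measure on $\mathbb{R}^2$ (ordered pairs, so both $(x,y)$ and $(y,x)$ are counted). The functions are regarded as defined almost everywhere; their values at the finitely many breakpoints are irrelevant to $I_{1,p}$. The symmetric decreasing rearrangement of a nonnegative measurable function $u$ on $\mathbb{R}$ with superlevel sets of finite measure is the even function, nonincreasing in $|x|$, whose superlevel sets $\{u^*>t\}$, $t>0$, are the open intervals centered at $0$ with the same length as $\{u>t\}$. $\log$ is the natural logarithm. *)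

(* Defs.v *)
From HB Require Import structures.
From mathcomp Require Import all_boot all_order all_algebra.
From mathcomp Require Import all_classical all_reals all_analysis.
Set Implicit Arguments.
Unset Strict Implicit.
Unset Printing Implicit Defensive.
Import Order.TTheory GRing.Theory Num.Theory.
Import numFieldNormedType.Exports.
Local Open Scope classical_set_scope.
Local Open Scope ring_scope.

(* The diagonal never belongs to the domain of integration, so the value of
   the kernel at x = y is irrelevant. *)
Definition threshold_functional (R : realType) (p : R) (w : R -> R) : \bar R :=
  (\int[lebesgue_measure \x lebesgue_measure]_(z in
       [set z : R * R | (1 < `|w z.1 - w z.2|)%R])
     ((`|z.1 - z.2| `^ (1 + p))^-1)%:E)%E.

(* [us] is the pointwise (lower semicontinuous) representative of the
   rearrangement: its superlevel sets are open intervals exactly, not just up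
   to null sets. The equation on the measure forces the superlevel sets of [u]
   to have finite length. *)
Definition symm_decr_rearr (R : realType) (u us : R -> R) : Prop :=
  [/\ forall x, 0 <= us x,
      forall x, us (- x) = us x,
      forall x y, `|x| <= `|y| -> us y <= us x
    & forall t, 0 < t -> exists r : R,
        [/\ 0 <= r,
            [set x | t < us x] = `]- r, r[%classic
          & lebesgue_measure [set x | t < u x] = (2 * r)%:E]].

(* The step functions are prescribed on open intervals only: their values at
   the breakpoints are left arbitrary. *)
Definition is_step_u (R : realType) (u : R -> R) : Prop :=
  [/\ forall x, 0 < x < 2 -> u x = 5 / 6,
      forall x, 2 < x < 4 -> u x = 5 / 3,
      forall x, 4 < x < 6 -> u x = 7 / 6,
      forall x, 6 < x < 8 -> u x = 1 / 3
    & forall x, x < 0 \/ 8 < x -> u x = 0].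

Definition is_step_ustar (R : realType) (us : R -> R) : Prop :=
  [/\ forall x, `|x| < 1 -> us x = 5 / 3,
      forall x, 1 < `|x| < 2 -> us x = 7 / 6,
      forall x, 2 < `|x| < 3 -> us x = 5 / 6,
      forall x, 3 < `|x| < 4 -> us x = 1 / 3
    & forall x, 4 < `|x| -> us x = 0].

Lemma symm_decr_rearr_unique (R : realType) (u v w : R -> R) :
  symm_decr_rearr u v -> symm_decr_rearr u w -> v =1 w.
Proof.
have le (f g : R -> R) x :
    symm_decr_rearr u f -> symm_decr_rearr u g -> f x <= g x.
  move=> [_ _ _ hf] [g0 _ _ hg]; rewrite leNgt; apply/negP => gf.
  have [gm mf] := midf_lt gf; set t := (_ / _) in gm mf.
  have t0 : 0 < t by exact: le_lt_trans (g0 x) gm.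
  have [r [_ fr ur]] := hf t t0; have [s [_ gs us]] := hg t t0.
  have rs : r = s.
    by move: us; rewrite ur => -[] /mulfI; apply; rewrite pnatr_eq0.
  have : [set x | t < f x] x by [].
  by rewrite fr rs -gs /= ltNge (ltW gm).
by move=> hv hw x; apply/eqP; rewrite eq_le !le.
Qed.

(* Main.v *)
Require Import Defs.
From HB Require Import structures.
From mathcomp Require Import all_boot all_order all_algebra.
From mathcomp Require Import all_classical all_reals all_analysis.
From mathcomp Require Import measurable_realfun ring lra.

(* Outside finitely many points, u and u* are both of the form
   1/3 1_(J0) + 1/2 1_(J1) + 1/3 1_(J2) + 1/2 1_(J3) with nested open intervals
   J0, ..., J3 of lengths 8, 6, 4, 2. For such a function w one has
   w(x) - w(y) > 1 exactly when x is in J2 and y is not in J0, or x is in J3 and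
   y is not in J1. So, the pairs with |w(x) - w(y)| > 1 being counted twice,
     I(w) / 2 = K(J2, J0) + K(J3, J1) - K(J3, J0),
   where K(J, J') is the integral of |x - y|^(-1-p) over x in J and y not in J'.
   By Tonelli and the fundamental theorem of calculus, K(]a, b[, ]c, d[) is
   G(d - a) - G(d - b) + G(b - c) - G(a - c) for any G with G'(t) = t^(-p) / p;
   G is - t^(1-p) / (p (p - 1)) if p > 1, and ln if p = 1. *)

Set Implicit Arguments.
Unset Strict Implicit.
Unset Printing Implicit Defensive.
Import Order.TTheory GRing.Theory Num.Theory.
Import numFieldNormedType.Exports.
Local Open Scope classical_set_scope.
Local Open Scope ring_scope.

(** * Limits, derivatives and continuity of real powers *)

Lemma powR_cvgyN (R : realType) (p : R) : 0 < p ->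
  t `^ (- p) @[t --> +oo] --> (0 : R).
Proof.
move=> p0; under eq_fun do rewrite powRN.
apply: (gtr0_cvgV0 (f := @powR R ^~ p) _).2.
  by near=> t; rewrite powR_gt0.
apply/cvgryPge => A; near=> t.
(* Raising this bound to the power [p] gives back the absolute value of [A]. *)
have Bt : `|A| `^ p^-1 <= t by near: t; exact: nbhs_pinfty_ge.
rewrite (le_trans (ler_norm A))// -[leLHS]powRr1//.
rewrite -[X in _ `^ X](mulVf (lt0r_neq0 p0)) powRrM.
by apply: ge0_ler_powR; rewrite ?nnegrE ?powR_ge0 ?(ltW p0)//
  (le_trans (powR_ge0 _ _) Bt).
Unshelve. all: by end_near. Qed.

Lemma is_derive_powRB (R : realType) (x y q : R) : x < y ->
  is_derive y 1 (fun y => (y - x) `^ q) (q * (y - x) `^ (q - 1)).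
Proof.
move=> xy; apply: is_derive_eq.
  by apply: (@is_derive1_comp _ (@powR R ^~ q) (fun y => y - x));
     apply: is_derive1_powR; rewrite subr_gt0.
by rewrite subr0 mulr1.
Qed.

Lemma continuous_powRBr (R : realType) (x y q : R) : x < y ->
  {for y, continuous (fun y => (y - x) `^ q)}.
Proof.
move=> xy; have h := is_derive_powRB q xy.
by apply: differentiable_continuous; apply/derivable1_diffP; apply: ex_derive.
Qed.

Lemma continuous_powRBl (R : realType) (x y q : R) : y < x ->
  {for y, continuous (fun y => (x - y) `^ q)}.
Proof.
move=> yx.
rewrite (_ : (fun y => _) = (fun y => (y - - x) `^ q) \o -%R); last first.
  by apply/funext => z; rewrite /= opprK addrC.
apply: continuous_comp; first exact: opp_continuous.
by apply: continuous_powRBr; rewrite ltrN2.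
Qed.

(** * Integrals of the kernel over half-lines *)

Section kernel.
Variables (R : realType) (p : R).
Local Notation mu := (@lebesgue_measure R).

Definition kernel (z : R * R) : R := (`|z.1 - z.2| `^ (1 + p))^-1.

Lemma kernel_ge0 z : 0 <= kernel z.
Proof. by rewrite invr_ge0 powR_ge0. Qed.

Lemma measurable_kernel : measurable_fun setT kernel.
Proof.
rewrite (_ : kernel = (@powR R ^~ (- (1 + p))) \o
    (Num.norm \o (fun z : R * R => z.1 - z.2))); last first.
  by apply/funext => z; rewrite /kernel /= powRN.
apply: measurableT_comp; first exact: measurable_powR.
apply: measurableT_comp; first exact: normr_measurable.
by apply: measurable_funB; [exact: measurable_fst|exact: measurable_snd].
Qed.

Hypothesis p0 : 0 < p.

Lemma integral_kernely (x d : R) : x < d ->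
  (\int[mu]_(y in `[d, +oo[) (kernel (x, y))%:E = ((d - x) `^ (- p) / p)%:E)%E.
Proof.
move=> xd.
(* On [y > x] the kernel is [f]. Its primitive [F] vanishes at infinity, so only the endpoint [d]
   contributes. *)
pose f y := (y - x) `^ (- p - 1); pose F y := - ((y - x) `^ (- p) / p).
have dF y : x < y -> is_derive y 1 F (f y).
  move=> xy; have := is_derive_powRB (- p) xy => h.
  apply: is_derive_eq; rewrite /f /GRing.scale /=; field.
  by rewrite gt_eqF.
have df y : x < y -> {for y, continuous f} by exact: continuous_powRBr.
have cF y : x < y -> {for y, continuous F}.
  move=> xy; have h := dF _ xy.
  by apply: differentiable_continuous; apply/derivable1_diffP; apply: ex_derive.
rewrite (@eq_integral _ _ _ mu _ (EFin \o f)); last first.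
  move=> y; rewrite inE/= in_itv/= andbT => dy; rewrite /=; congr EFin.
  rewrite /kernel /f /= distrC ger0_norm; last by lra.
  by rewrite -powRN; congr (_ `^ _); lra.
rewrite (@ge0_continuous_FTC2y _ f F d 0).
- by rewrite sub0e /F -EFinN opprK.
- by move=> y _; exact: powR_ge0.
- apply/continuous_within_itvcyP; split.
    by move=> y; rewrite in_itv/= andbT => dy; apply: df; lra.
  by apply: cvg_at_right_filter; exact: df.
- rewrite /F -oppr0; apply: cvgN; rewrite -[X in _ --> X](mul0r p^-1).
  apply: cvgMl.
  apply: (@cvg_comp _ _ _ (fun y : R => y - x) (fun t => t `^ (- p))
    _ (@pinfty_nbhs R)); last exact: powR_cvgyN.
  exact: cvg_addrr.
- by move=> y dy; have h := dF y (lt_trans xd dy); exact: ex_derive.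
- by apply: cvg_at_right_filter; exact: cF.
- move=> y; rewrite in_itv/= andbT => dy.
  by have h := dF y (lt_trans xd dy); rewrite derive1E derive_val.
Qed.

(** The reflection of both variables reduces this to [integral_kernely] at the points [- x] and
    [- c]. *)
Lemma integral_kernelNy (x c : R) : c < x ->
  (\int[mu]_(y in `]-oo, c]) (kernel (x, y))%:E = ((x - c) `^ (- p) / p)%:E)%E.
Proof.
move=> cx.
pose f y := (x - y) `^ (- p - 1).
have df y : y < x -> {for y, continuous f} by exact: continuous_powRBl.
rewrite (@eq_integral _ _ _ mu _ (EFin \o f)); last first.
  move=> y; rewrite inE/= in_itv/= => yc; rewrite /=; congr EFin.
  rewrite /kernel /f /= ger0_norm; last by lra.
  by rewrite -powRN; congr (_ `^ _); lra.
rewrite -[in LHS](opprK c) ge0_integration_by_substitutionNy ?opprK.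
- rewrite (@eq_integral _ _ _ mu _ (fun y => (kernel (- x, y))%:E)); last first.
    move=> y; rewrite inE/= in_itv/= andbT => cy; rewrite /kernel /f /= opprK.
    rewrite -normrN ger0_norm -?powRN; last by lra.
    by congr ((_ `^ _)%:E); lra.
  by rewrite integral_kernely; [congr ((_ `^ _ / _)%:E); lra|lra].
- apply/continuous_within_itvNycP; split.
    by move=> y; rewrite in_itv/= => yc; apply: df; lra.
  by apply: cvg_at_left_filter; exact: df.
- by move=> y _; exact: powR_ge0.
Qed.

End kernel.

(** * Insensitivity of measures and integrals to finitely many points *)

Section finite_exceptional_set.
Variables (R : realType) (s : seq R).
Local Notation mu := (@lebesgue_measure R).

Lemma countable_seqI (A : set R) : countable (A `&` [set` s]).
Proof.
apply: finite_set_countable; apply: (@sub_finite_set _ _ [set` s]).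
  exact: subIsetr.
exact: finite_seq.
Qed.

Lemma measurable_seqI (A : set R) : measurable (A `&` [set` s]).
Proof. exact/countable_measurable/countable_seqI. Qed.

Lemma measurable_seq : measurable [set` s].
Proof. by rewrite -[X in measurable X]setTI; exact: measurable_seqI. Qed.

Lemma lebesgue_measure_seq : mu [set` s] = 0%E.
Proof.
rewrite -[X in mu X]setTI; exact/countable_lebesgue_measure0/countable_seqI.
Qed.

(** Preimages under [f] and [g] differ by a subset of the finite set [s], and every such subset is
    measurable. This is what allows arbitrary values at the breakpoints. *)
Lemma measurable_fun_eq_off d (T : measurableType d) (f g : R -> T) :
  measurable_fun setT g -> (forall x, x \notin s -> f x = g x) ->
  measurable_fun setT f.
Proof.
move=> mg fg _ Y mY; rewrite setTI.
rewrite (_ : f @^-1` Y =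
    (g @^-1` Y `\` [set` s]) `|` (f @^-1` Y `&` [set` s])); last first.
  apply/seteqP; split => x /=.
    by have [xs|xs] := boolP (x \in s); [right|left; rewrite -fg].
  by move=> [[+ /negP xs]|[]//]; rewrite fg.
apply: measurableU.
  apply: measurableD; first by rewrite -[X in measurable X]setTI; exact: mg.
  exact: measurable_seq.
exact: measurable_seqI.
Qed.

Lemma lebesgue_measure_eq_off (A B : set R) :
  measurable B -> (forall x, x \notin s -> A x <-> B x) -> mu A = mu B.
Proof.
move=> mB AB.
have ms := measurable_seq.
have mA : measurable A.
  rewrite (_ : A = (B `\` [set` s]) `|` (A `&` [set` s])).
    by apply: measurableU; [exact: measurableD|exact: measurable_seqI].
  apply/seteqP; split => x /=.
    by have [xs|/[dup] xs /AB AxBx] := boolP (x \in s);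
      [right|left; rewrite -AxBx].
  by move=> [[+ /negP xs]|[]//]; rewrite -AB.
have le (C D : set R) : measurable C -> measurable D ->
    C `<=` D `|` [set` s] -> (mu C <= mu D)%E.
  move=> mC mD CD.
  rewrite -(@measureU0 _ _ _ mu _ _ mD ms lebesgue_measure_seq).
  by apply: le_measure; rewrite ?inE//; exact: measurableU.
apply/eqP; rewrite eq_le; apply/andP; split; apply: le => // x;
  by have [xs|/AB ABx] := boolP (x \in s); [right|left; apply/ABx].
Qed.

Lemma ge0_integral_eq_off (f g : R -> \bar R) :
  measurable_fun setT f -> measurable_fun setT g ->
  (forall x, 0 <= f x)%E -> (forall x, 0 <= g x)%E ->
  (forall x, x \notin s -> f x = g x) ->
  (\int[mu]_x f x = \int[mu]_x g x)%E.
Proof.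
move=> mf mg f0 g0 fg; apply: ge0_ae_eq_integral => //.
exists [set` s]; split.
- exact: measurable_seq.
- exact: lebesgue_measure_seq.
- move=> x /= fgx; apply: contrapT => /negP xs; apply: fgx => _; exact: fg.
Qed.

(** By Tonelli, the one-variable statement is applied twice: to the integrals in [x], then to the
    inner integrals in [y] for each [x] outside [s]. *)
Lemma ge0_integral_prod_eq_off (f g : R * R -> \bar R) :
  measurable_fun setT f -> measurable_fun setT g ->
  (forall z, 0 <= f z)%E -> (forall z, 0 <= g z)%E ->
  (forall x y, x \notin s -> y \notin s -> f (x, y) = g (x, y)) ->
  (\int[mu \x mu]_z f z = \int[mu \x mu]_z g z)%E.
Proof.
move=> mf mg f0 g0 fg; rewrite !fubini_tonelli1//.
apply: ge0_integral_eq_off.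
- exact: measurable_fun_fubini_tonelli_F.
- exact: measurable_fun_fubini_tonelli_F.
- by move=> x; exact: integral_ge0.
- by move=> x; exact: integral_ge0.
- move=> x xs; apply: ge0_integral_eq_off.
  + exact: measurableT_comp.
  + exact: measurableT_comp.
  + by move=> y; exact: f0.
  + by move=> y; exact: g0.
  + by move=> y ys; exact: fg.
Qed.

End finite_exceptional_set.

(** Both sides are the same iterated integral, by Tonelli in one order on the left and in the other
    order on the right. *)
Lemma ge0_integral_swap (R : realType) (f : R * R -> \bar R) :
  measurable_fun setT f -> (forall z, 0 <= f z)%E ->
  (\int[@lebesgue_measure R \x @lebesgue_measure R]_z f (z.2, z.1) =
   \int[@lebesgue_measure R \x @lebesgue_measure R]_z f z)%E.
Proof.
move=> mf f0.
have mfs : measurable_fun setT (fun z : R * R => f (z.2, z.1)).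
  by apply: (measurableT_comp mf); exact: measurable_swap.
by rewrite fubini_tonelli1// [RHS]fubini_tonelli2.
Qed.

(** * Integrals of the kernel over product sets *)

Definition escape_integral (R : realType) (G : R -> R) (a b c d : R) : R :=
  G (d - a) - G (d - b) + (G (b - c) - G (a - c)).

Section kernel_integral.
Variables (R : realType) (p : R).
Local Notation mu := (@lebesgue_measure R).

(** The set enters through its indicator, over the whole plane, so that pointwise identities between
    indicators can be integrated. *)
Definition kernel_integral (A : set (R * R)) : \bar R :=
  (\int[mu \x mu]_z (kernel p z * \1_A z)%:E)%E.

Lemma measurable_kernel_indic (A : set (R * R)) : measurable A ->
  measurable_fun setT (fun z => (kernel p z * \1_A z)%:E).
Proof.
move=> mA; apply/measurable_EFinP; apply: measurable_funM.
  exact: measurable_kernel.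
exact: measurable_indic.
Qed.

Lemma kernel_indic_ge0 (A : set (R * R)) z : (0 <= (kernel p z * \1_A z)%:E)%E.
Proof. by rewrite lee_fin mulr_ge0// kernel_ge0. Qed.

Lemma kernel_integralX (X Y : set R) : measurable X -> measurable Y ->
  kernel_integral (X `*` Y) =
  (\int[mu]_(x in X) \int[mu]_(y in Y) (kernel p (x, y))%:E)%E.
Proof.
move=> mX mY; rewrite /kernel_integral fubini_tonelli1; last 2 first.
- by apply: measurable_kernel_indic; exact: measurableX.
- exact: kernel_indic_ge0.
rewrite [RHS]integral_mkcond; apply: eq_integral => x _.
rewrite /fubini_F patchE; case: ifPn => xX.
  rewrite [RHS]integral_mkcond; apply: eq_integral => y _.
  by rewrite patchE indicE in_setX xX /=; case: ifPn; rewrite ?mulr1 ?mulr0.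
apply: integral0_eq => y _.
by rewrite indicE in_setX (negbTE xX) mulr0.
Qed.

Hypothesis p0 : 0 < p.
Variable G : R -> R.
Hypothesis dG : forall t : R, 0 < t -> is_derive t 1 G (t `^ (- p) / p).

Lemma integral_kernelC (c d x : R) : c < x < d ->
  (\int[mu]_(y in ~` `]c, d[) (kernel p (x, y))%:E =
   ((x - c) `^ (- p) / p + (d - x) `^ (- p) / p)%:E)%E.
Proof.
move=> /andP[cx xd].
rewrite (_ : ~` `]c, d[ = `]-oo, c] `|` `[d, +oo[); last first.
  apply/seteqP; split => y /=; rewrite !in_itv/= andbT.
    by move=> /negP; rewrite negb_and -!leNgt => /orP.
  by move=> h; apply/negP; rewrite negb_and -!leNgt; apply/orP.
rewrite ge0_integral_setU//.
- by rewrite integral_kernelNy// integral_kernely.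
- apply/measurable_EFinP; apply: measurable_funTS.
  apply: (measurableT_comp (measurable_kernel p)).
  exact: measurable_pair1.
- by move=> y _; rewrite lee_fin kernel_ge0.
- apply/disj_setPS => y [/=]; rewrite !in_itv/= andbT; lra.
Qed.

(** The part of the complement above [d] yields the first difference in [escape_integral], the part
    below [c] the second. The gaps [c < a] and [b < d] keep the inner integral [h] continuous up to
    the endpoints, so the fundamental theorem applies to its primitive [H]. *)
Lemma kernel_integral_itvC (a b c d : R) : a < b -> c < a -> b < d ->
  kernel_integral (`]a, b[ `*` ~` `]c, d[) = (escape_integral G a b c d)%:E.
Proof.
move=> ab ca bd.
pose h x := (x - c) `^ (- p) / p + (d - x) `^ (- p) / p.
pose H x := G (x - c) - G (d - x).
have dH x : c < x < d -> is_derive x 1 H (h x).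
  move=> /andP[cx xd].
  have d1 : is_derive x 1 (G \o (fun x => x - c)) ((x - c) `^ (- p) / p).
    apply: is_derive_eq; first by apply: is_derive1_comp; apply: dG; lra.
    by rewrite subr0 mulr1.
  have d2 : is_derive x 1 (G \o (fun x => d - x)) (- ((d - x) `^ (- p) / p)).
    apply: is_derive_eq; first by apply: is_derive1_comp; apply: dG; lra.
    by rewrite /GRing.scale /=; ring.
  by apply: is_derive_eq; rewrite opprK.
have ch x : c < x < d -> {for x, continuous h}.
  move=> /andP[cx xd]; apply: cvgD; apply: cvgMl.
    exact: continuous_powRBr.
  exact: continuous_powRBl.
have cH x : c < x < d -> {for x, continuous H}.
  move=> cxd; have h' := dH _ cxd.
  by apply: differentiable_continuous; apply/derivable1_diffP; apply: ex_derive.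
rewrite kernel_integralX//; last exact: measurableC.
rewrite (@eq_integral _ _ _ mu _ (EFin \o h)); last first.
  move=> x; rewrite inE/= in_itv/= => axb; rewrite integral_kernelC//; lra.
have mh : measurable_fun `]a, b[ (EFin \o h).
  apply/measurable_EFinP; apply: open_continuous_measurable_fun.
    exact: interval_open.
  move=> x; rewrite inE/= in_itv/= => axb; apply: ch; lra.
(* The endpoints are added, since the fundamental theorem is about a closed interval. *)
rewrite -(@integral_itv_bndoo _ a b _ true false)//.
rewrite (@continuous_FTC2 _ h H)//.
- by rewrite -EFinB /H /escape_integral; congr EFin; lra.
- apply/continuous_within_itvP => //; split.
  + by move=> x; rewrite in_itv/= => axb; apply: ch; lra.
  + by apply: cvg_at_right_filter; apply: ch; lra.
  + by apply: cvg_at_left_filter; apply: ch; lra.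
- split.
  + move=> x; rewrite in_itv/= => axb; have cxd : c < x < d by lra.
    by have h' := dH _ cxd; exact: ex_derive.
  + by apply: cvg_at_right_filter; apply: cH; lra.
  + by apply: cvg_at_left_filter; apply: cH; lra.
- move=> x; rewrite in_itv/= => axb; have cxd : c < x < d by lra.
  by have h' := dH _ cxd; rewrite derive1E derive_val.
Qed.

End kernel_integral.

(** * Sums of four nested layers *)

Section layers.
Variable R : realType.
Implicit Types a b : nat -> R.

Definition in_layer a b i (x : R) : bool := a i < x < b i.

(* The partial sums of the heights are 1/3, 5/6, 7/6, 5/3, the positive values
   of [u]. *)
Definition layers a b (x : R) : R :=
  3^-1 * (in_layer a b 0 x)%:R + 2^-1 * (in_layer a b 1 x)%:R +
  3^-1 * (in_layer a b 2 x)%:R + 2^-1 * (in_layer a b 3 x)%:R.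

Definition nested a b :=
  forall i, (i < 3)%N -> a i <= a i.+1 /\ b i.+1 <= b i.

(** Nesting leaves five of the sixteen membership patterns: at level k a point lies in exactly the
    first k layers. *)
Variant nested_spec : bool -> bool -> bool -> bool -> Prop :=
  | Level0 : nested_spec false false false false
  | Level1 : nested_spec true false false false
  | Level2 : nested_spec true true false false
  | Level3 : nested_spec true true true false
  | Level4 : nested_spec true true true true.

Lemma nestedP a b (x : R) : nested a b ->
  nested_spec (in_layer a b 0 x) (in_layer a b 1 x)
    (in_layer a b 2 x) (in_layer a b 3 x).
Proof.
move=> nab.
have up i : (i < 3)%N -> in_layer a b i.+1 x -> in_layer a b i x.
  by rewrite /in_layer => /nab[? ?] ?; lra.
have := up 0%N isT; have := up 1%N isT; have := up 2%N isT.
case: (in_layer a b 0 x); case: (in_layer a b 1 x);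
  case: (in_layer a b 2 x); case: (in_layer a b 3 x);
  try by constructor.
all: move=> h1 h2 h3; by [have := h1 isT|have := h2 isT|have := h3 isT].
Qed.

Lemma in_layerE a b i :
  (fun x => (in_layer a b i x)%:R) = \1_`]a i, b i[ :> (R -> R).
Proof. by apply/funext => x; rewrite indicE mem_setE in_itv. Qed.

Lemma measurable_layers a b : measurable_fun setT (layers a b).
Proof.
have mi i : measurable_fun setT (fun x : R => (in_layer a b i x)%:R : R).
  by rewrite in_layerE; apply: measurable_indic; exact: measurable_itv.
rewrite /layers; do !apply: measurable_funD; apply: measurable_funM => //.
Qed.

(* The hypothesis on index 4 makes [`]a 4, b 4[] the empty superlevel set of the
   heights [t >= 5 / 3]. The index [i] depends on [t] only, so that layers of
   the same widths are equimeasurable. *)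
Lemma layers_superlevel (t : R) : 0 < t -> exists i, forall a b,
  nested a b -> a 4%N = b 4%N ->
  [set x | t < layers a b x] = `]a i, b i[%classic.
Proof.
move=> t0.
suff [i hi] : exists i, forall a b x, nested a b -> a 4%N = b 4%N ->
    (t < layers a b x) = in_layer a b i x.
  exists i => a b nab ab4; apply/seteqP; split => x /=;
  by rewrite in_itv/= hi.
have [t1|t1] := ltP t (1 / 3); [exists 0%N|
have [t2|t2] := ltP t (5 / 6); [exists 1%N|
have [t3|t3] := ltP t (7 / 6); [exists 2%N|
have [t4|t4] := ltP t (5 / 3); [exists 3%N|exists 4%N]]]] => a b x nab ab4.
5: have -> : in_layer a b 4 x = false.
5: by apply/negbTE/negP; rewrite /in_layer; lra.
all: rewrite /layers; case: (nestedP x nab) => /=; case: ltP => // h.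
all: exfalso; lra.
Qed.

(* The extra term on the left compensates the overlap of the two terms on the
   right. *)
Lemma layers_jump a b x y : nested a b ->
  (1 < layers a b x - layers a b y)%R%:R +
    (in_layer a b 3 x)%:R * (~~ in_layer a b 0 y)%:R =
  (in_layer a b 2 x)%:R * (~~ in_layer a b 0 y)%:R +
    (in_layer a b 3 x)%:R * (~~ in_layer a b 1 y)%:R :> R.
Proof.
move=> nab; rewrite /layers.
case: (nestedP x nab); case: (nestedP y nab).
all: case: ltP => /= h; lra.
Qed.

End layers.

(** * The threshold functional of nested layers *)

Lemma mem_mkset T (P : pred T) x : (x \in [set z | P z]) = P x.
Proof. by apply/idP/idP; rewrite inE. Qed.

Section threshold.
Variables (R : realType) (p : R).

Lemma measurable_jump (w : R -> R) : measurable_fun setT w ->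
  measurable [set z : R * R | (1 < w z.1 - w z.2)%R].
Proof.
move=> mw.
rewrite (_ : mkset _ = (fun z => w z.1 - w z.2) @^-1` `]1, +oo[); last first.
  by apply/seteqP; split => z /=; rewrite in_itv/= andbT.
rewrite -[X in measurable X]setTI.
apply: measurable_funB => //.
  by apply: measurableT_comp => //; exact: measurable_fst.
by apply: measurableT_comp => //; exact: measurable_snd.
Qed.

(** The domain of integration is the disjoint union of the set of upward jumps and that of downward
    jumps. The two are mirror images in the diagonal, and the kernel is symmetric. *)
Lemma threshold_functionalE (w : R -> R) : measurable_fun setT w ->
  threshold_functional p w =
  (kernel_integral p [set z | (1 < w z.1 - w z.2)%R] +
   kernel_integral p [set z | (1 < w z.1 - w z.2)%R])%E.
Proof.
move=> mw; set S := [set z | _].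
have mS : measurable S := measurable_jump mw.
(* Only the second summand is mirrored, so that the sum can be compared pointwise with the
   integrand. *)
rewrite {2}/kernel_integral -ge0_integral_swap; last 2 first.
- exact: measurable_kernel_indic.
- exact: kernel_indic_ge0.
rewrite -ge0_integralD//; last 4 first.
- by move=> z _; exact: kernel_indic_ge0.
- exact: measurable_kernel_indic.
- by move=> z _; exact: kernel_indic_ge0.
- apply: (measurableT_comp (measurable_kernel_indic p mS)).
  exact: measurable_swap.
rewrite /threshold_functional [LHS]integral_mkcond.
apply: eq_integral => -[x y] _.
rewrite patchE /= -EFinD {2}/kernel /= (distrC y x) -/(kernel p (x, y)).
rewrite -mulrDr !indicE !mem_mkset /=.
have -> : (1 < `|w x - w y|) = (1 < w x - w y) || (1 < w y - w x).
  by rewrite ltr_normr opprB.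
case: (ltP 1 (w x - w y)) => xy; case: (ltP 1 (w y - w x)) => yx /=.
- exfalso; lra.
- by rewrite addr0 mulr1.
- by rewrite add0r mulr1.
- by rewrite addr0 mulr0.
Qed.

End threshold.

Lemma threshold_functional_layers (R : realType) (p : R) (G w : R -> R)
    (s : seq R) (a b : nat -> R) :
  0 < p -> (forall t : R, 0 < t -> is_derive t 1 G (t `^ (- p) / p)) ->
  nested a b -> a 3%N < b 3%N ->
  a 0%N < a 2%N -> a 1%N < a 3%N -> b 2%N < b 0%N -> b 3%N < b 1%N ->
  (forall x, x \notin s -> w x = layers a b x) ->
  threshold_functional p w =
    (2 * (escape_integral G (a 2%N) (b 2%N) (a 0%N) (b 0%N)
        + escape_integral G (a 3%N) (b 3%N) (a 1%N) (b 1%N)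
        - escape_integral G (a 3%N) (b 3%N) (a 0%N) (b 0%N)))%:E.
Proof.
move=> p0 dG nab ab3 a02 a13 b20 b31 wab.
have mw : measurable_fun setT w.
  exact: measurable_fun_eq_off (measurable_layers a b) wab.
(* With the strict inequalities assumed, these place layer 3 strictly inside layer 0 and make layer
   2 nonempty. *)
have [a23 b32] := nab 2%N isT.
pose J i j : set (R * R) := `]a i, b i[ `*` ~` `]a j, b j[.
have mJ i j : measurable (J i j).
  by apply: measurableX => //; exact: measurableC.
set S := [set z : R * R | (1 < w z.1 - w z.2)%R].
have mS : measurable S := measurable_jump mw.
(* The overlap is added on the left rather than subtracted on the right: all integrands stay
   nonnegative, and no difference of extended reals is formed. *)
have : (kernel_integral p S + kernel_integral p (J 3%N 0%N) =
    kernel_integral p (J 2%N 0%N) + kernel_integral p (J 3%N 1%N))%E.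
  rewrite /kernel_integral -!ge0_integralD//; first last.
  all: try by [exact: measurable_kernel_indic|
    move=> z _; exact: kernel_indic_ge0].
  apply: (@ge0_integral_prod_eq_off _ s).
  + by apply: emeasurable_funD; exact: measurable_kernel_indic.
  + by apply: emeasurable_funD; exact: measurable_kernel_indic.
  + by move=> z; apply: adde_ge0; exact: kernel_indic_ge0.
  + by move=> z; apply: adde_ge0; exact: kernel_indic_ge0.
  + move=> x y xs ys; rewrite -!EFinD -!mulrDr; congr ((_ * _)%:E).
    have inJ i j : ((x, y) \in J i j)%:R =
        (in_layer a b i x)%:R * (~~ in_layer a b j y)%:R :> R.
      by rewrite in_setX in_setC !mem_setE !in_itv /= -natrM mulnb.
    by rewrite !indicE mem_mkset !inJ /= !wab// layers_jump.
rewrite !(kernel_integral_itvC p0 dG); [|lra..].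
rewrite (threshold_functionalE p mw) -/S -EFinD.
(* An infinite value would contradict the identity, whose other terms are finite. *)
case: (kernel_integral p S) => [r /= [h]| //|//].
rewrite -!EFinD; congr EFin; lra.
Qed.

(** * Inequalities between negative powers *)

Lemma ltr_powRN (R : realType) (q x y : R) : 0 < q -> 0 < x -> x < y ->
  y `^ (- q) < x `^ (- q).
Proof.
move=> q0 x0 xy; have y0 : 0 < y by exact: lt_trans xy.
rewrite !powRN ltf_pV2 ?posrE ?powR_gt0//.
by apply: gt0_ltr_powR; rewrite ?nnegrE ?ltW.
Qed.

(** This is the strict convexity of t^(-q) in terms of unit increments. The difference [g] has a
    negative derivative because t^(-(q+1)) decreases, and the mean value theorem concludes. *)
Lemma ltr_powRN_diff (R : realType) (q x y : R) : 0 < q -> 0 < x -> x < y ->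
  y `^ (- q) - (y + 1) `^ (- q) < x `^ (- q) - (x + 1) `^ (- q).
Proof.
move=> q0 x0 xy.
(* The shifts [t - 0] and [t - -1] are the form of [is_derive_powRB]. *)
pose g (t : R) := (t - 0) `^ (- q) - (t - -1) `^ (- q).
have dg (t : R) : 0 < t ->
    is_derive t 1 g (- q * (t `^ (- (q + 1)) - (t + 1) `^ (- (q + 1)))).
  move=> t0; have h1 := is_derive_powRB (- q) t0.
  have t1 : -1 < t by lra.
  have h2 := is_derive_powRB (- q) t1.
  by apply: is_derive_eq; rewrite subr0 opprK opprD mulrBr.
have cg t : 0 < t -> {for t, continuous g}.
  move=> t0; have h := dg _ t0.
  by apply: differentiable_continuous; apply/derivable1_diffP; apply: ex_derive.
have dgxy (t : R) : t \in `]x, y[ ->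
    is_derive t 1 g (- q * (t `^ (- (q + 1)) - (t + 1) `^ (- (q + 1)))).
  by rewrite in_itv/= => xty; apply: dg; lra.
have cgxy : {within `[x, y], continuous g}.
  apply/continuous_within_itvP => //; split.
  - by move=> t; rewrite in_itv/= => xty; apply: cg; lra.
  - by apply: cvg_at_right_filter; apply: cg.
  - by apply: cvg_at_left_filter; apply: cg; lra.
have [e] := MVT xy dgxy cgxy; rewrite in_itv/= => /andP[xe _].
have lt_pow : (e + 1) `^ (- (q + 1)) < e `^ (- (q + 1)).
  by apply: ltr_powRN; lra.
move: lt_pow xy; rewrite -subr_gt0 -[x < y]subr_gt0.
(* The product of the three positive factors is the opposite of the increment of [g] from [x] to
   [y]. *)
move=> /(mulr_gt0 q0)/mulr_gt0/[apply].
rewrite /g !subr0 !opprK; lra.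
Qed.

(* With h(t) = t^-q the expression is F(2) - F(3) for
   F(t) = h(t) - h(t+1) - h(t+2) + h(t+3), and F decreases because - h' is
   strictly convex. *)
Lemma powRN_alternating_gt0 (R : realType) (q : R) : 0 < q ->
  0 < 2 `^ (- q) - 2 * 3 `^ (- q) + 2 * 5 `^ (- q) - 6 `^ (- q) :> R.
Proof.
move=> q0.
pose F (t : R) := (t - 0) `^ (- q) - (t - -1) `^ (- q)
  - (t - -2) `^ (- q) + (t - -3) `^ (- q).
pose dF (t : R) := - q * (t `^ (- (q + 1)) - (t + 1) `^ (- (q + 1))
  - ((t + 2) `^ (- (q + 1)) - (t + 2 + 1) `^ (- (q + 1)))).
have dFE (t : R) : 0 < t -> is_derive t 1 F (dF t).
  move=> t0; have h0 := is_derive_powRB (- q) t0.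
  have t1 : -1 < t by lra.
  have h1 := is_derive_powRB (- q) t1.
  have t2 : -2 < t by lra.
  have h2 := is_derive_powRB (- q) t2.
  have t3 : -3 < t by lra.
  have h3 := is_derive_powRB (- q) t3.
  apply: is_derive_eq; rewrite /dF subr0 !opprK opprD.
  have -> : t + 2 + 1 = t + 3 by lra.
  lra.
have cF t : 0 < t -> {for t, continuous F}.
  move=> t0; have h := dFE _ t0.
  by apply: differentiable_continuous; apply/derivable1_diffP; apply: ex_derive.
have lt23 : 2 < 3 :> R by lra.
have dF23 (t : R) : t \in `]2, 3[ -> is_derive t 1 F (dF t).
  by rewrite in_itv/= => t23; apply: dFE; lra.
have cF23 : {within `[2, 3], continuous F}.
  apply/continuous_within_itvP => //; split.
  - by move=> t; rewrite in_itv/= => t23; apply: cF; lra.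
  - by apply: cvg_at_right_filter; apply: cF.
  - by apply: cvg_at_left_filter; apply: cF; lra.
have [c] := MVT lt23 dF23 cF23; rewrite in_itv/= => /andP[c2 _].
(* As - h'(t) = q t^(-(q+1)), its convexity is used through [ltr_powRN_diff] with exponent [q + 1]
   at the points [c] and [c + 2]. *)
have lt_pow : (c + 2) `^ (- (q + 1)) - (c + 2 + 1) `^ (- (q + 1)) <
    c `^ (- (q + 1)) - (c + 1) `^ (- (q + 1)).
  by apply: ltr_powRN_diff; lra.
move: lt_pow; rewrite -subr_gt0 => /(mulr_gt0 q0).
(* Once the arguments are evaluated, the powers of 4 cancel in F(2) - F(3). *)
rewrite /F /dF !subr0 !opprK.
have -> : 2 + 1 = 3 :> R by lra.
have -> : 2 + 2 = 4 :> R by lra.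
have -> : 2 + 3 = 5 :> R by lra.
have -> : 3 + 1 = 4 :> R by lra.
have -> : 3 + 2 = 5 :> R by lra.
have -> : 3 + 3 = 6 :> R by lra.
lra.
Qed.

(** * The primitives G for p > 1 and for p = 1 *)

Lemma is_derive_powR_primitive (R : realType) (p t : R) : 1 < p -> 0 < t ->
  is_derive t 1 (fun t : R => - (t `^ (1 - p) / (p * (p - 1))))
    (t `^ (- p) / p).
Proof.
move=> p1 t0; have h := is_derive1_powR (1 - p) t0.
apply: is_derive_eq; rewrite /GRing.scale /= addrAC subrr add0r; field.
by apply/andP; split; apply: lt0r_neq0; lra.
Qed.

(** The derivative 1/t is written in the shape t^(-p) / p at p = 1, to match the hypothesis on [G]
    in the general lemmas. *)
Lemma is_derive_ln_primitive (R : realType) (t : R) : 0 < t ->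
  is_derive t 1 (@ln R) (t `^ (- 1) / 1).
Proof.
by move=> t0; rewrite divr1 powR_inv1 ?ltW//; exact: is_derive1_ln.
Qed.

(** * The two step functions *)

Section step_functions.
Variable R : realType.

(** The layers are the superlevel sets of the step functions. Beyond index 3 the default value 0 of
    [nth] makes both endpoints equal, as [layers_superlevel] requires at index 4. *)
Definition u_left : nat -> R := nth 0 [:: 0; 0; 2; 2].
Definition u_right : nat -> R := nth 0 [:: 8; 6; 6; 4].
Definition ustar_right : nat -> R := nth 0 [:: 4; 3; 2; 1].
Definition ustar_left (i : nat) : R := - ustar_right i.

Lemma nested_u : nested u_left u_right.
Proof.
move=> [|[|[|//]]] _; rewrite /u_left /u_right /=; split; lra.
Qed.

Lemma nested_ustar : nested ustar_left ustar_right.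
Proof.
move=> [|[|[|//]]] _; rewrite /ustar_left /ustar_right /=; split; lra.
Qed.

Lemma in_layer_ustar i x :
  in_layer ustar_left ustar_right i x = (`|x| < ustar_right i).
Proof. by rewrite ltr_norml. Qed.

Ltac decide_indicators :=
  repeat match goal with |- context [nat_of_bool ?b] =>
    first [have -> /= : b by lra|have -> /= : b = false by apply/negbTE; lra]
  end.

Lemma is_step_u_layers (u : R -> R) x : is_step_u u ->
  x \notin [:: 0; 2; 4; 6; 8] -> u x = layers u_left u_right x.
Proof.
move=> [u1 u2 u3 u4 u5].
rewrite !inE !negb_or !neq_lt.
move=> /and5P[/orP h0 /orP h2 /orP h4 /orP h6 /orP h8].
rewrite /layers /in_layer /u_left /u_right /=.
(* The breakpoints are tested from left to right, which leaves six intervals. *)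
case: h0 => h0; last case: h2 => h2; last case: h4 => h4;
  last case: h6 => h6; last case: h8 => h8;
  [rewrite u5; last by left|rewrite u1; last lra|rewrite u2; last lra|
   rewrite u3; last lra|rewrite u4; last lra|rewrite u5; last by right].
all: clear -h0 h2 h4 h6 h8; decide_indicators; lra.
Qed.

Lemma is_step_ustar_layers (us : R -> R) x : is_step_ustar us ->
  `|x| \notin [:: 1; 2; 3; 4] -> us x = layers ustar_left ustar_right x.
Proof.
move=> [u1 u2 u3 u4 u5].
rewrite !inE !negb_or !neq_lt.
move=> /and4P[/orP h1 /orP h2 /orP h3 /orP h4].
rewrite /layers !in_layer_ustar /ustar_right /=.
case: h1 => h1; last case: h2 => h2; last case: h3 => h3; last case: h4 => h4;
  [rewrite u1//|rewrite u2; last lra|rewrite u3; last lra|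
   rewrite u4; last lra|rewrite u5//].
all: clear -h1 h2 h3 h4; decide_indicators; lra.
Qed.

(** At each height the superlevel sets of both functions are layers of the same index, and these
    have the same length. Since the layers are open, the centered ones are superlevel sets exactly,
    with no null set removed. *)
Lemma symm_decr_rearr_layers (u : R -> R) : is_step_u u ->
  symm_decr_rearr u (layers ustar_left ustar_right).
Proof.
move=> hu.
split.
- by move=> x; rewrite /layers !addr_ge0// mulr_ge0.
- by move=> x; rewrite /layers !in_layer_ustar normrN.
- move=> x y xy; rewrite /layers !in_layer_ustar.
  have le i : (`|y| < ustar_right i)%R%:R <= (`|x| < ustar_right i)%R%:R :> R.
    by rewrite ler_nat; case: ltP => // /(le_lt_trans xy) ->.
  by do !apply: lerD; apply: ler_wpM2l.
- move=> t t0; have [i hi] := layers_superlevel t0.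
  exists (ustar_right i).
  have [right_ge0 length_eq] :
      0 <= ustar_right i /\ 2 * ustar_right i = u_right i - u_left i.
    move: i {hi} => [|[|[|[|i]]]];
    by rewrite /ustar_right /u_right /u_left /= ?nth_nil; split; lra.
  split => //.
    rewrite hi//; first exact: nested_ustar.
    by rewrite /ustar_left oppr0.
  rewrite (@lebesgue_measure_eq_off _ [:: 0; 2; 4; 6; 8] _
    `]u_left i, u_right i[%classic) //.
    rewrite lebesgue_measure_itv /= lte_fin.
    (* In the degenerate case the length is zero, because [ustar_right i] is nonnegative. *)
    by case: ltP => h; rewrite length_eq ?EFinB//; congr EFin; lra.
  move=> x xs; rewrite -hi//=; last exact: nested_u.
  by rewrite is_step_u_layers.
Qed.

Variables (p : R) (G : R -> R).
Hypothesis p0 : 0 < p.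
Hypothesis dG : forall t : R, 0 < t -> is_derive t 1 G (t `^ (- p) / p).

(** The coefficients of [G] sum to zero, so the choice of the primitive is immaterial. *)
Lemma threshold_functional_u (u : R -> R) : is_step_u u ->
  threshold_functional p u = (2 * (G 6 + 2 * G 4 - 3 * G 2))%:E.
Proof.
move=> hu.
rewrite (threshold_functional_layers p0 dG nested_u _ _ _ _ _
  (fun x => is_step_u_layers hu (x := x)));
  rewrite /u_left /u_right /escape_integral /=; [|lra..].
(* The arguments of [G] are evaluated first, so that its values can serve as atoms for [lra]. *)
have -> : 8 - 2 = 6 :> R by lra.
have -> : 8 - 6 = 2 :> R by lra.
have -> : 6 - 0 = 6 :> R by lra.
have -> : 2 - 0 = 2 :> R by lra.
have -> : 6 - 2 = 4 :> R by lra.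
have -> : 6 - 4 = 2 :> R by lra.
have -> : 4 - 0 = 4 :> R by lra.
have -> : 8 - 4 = 4 :> R by lra.
by congr EFin; lra.
Qed.

Lemma threshold_functional_ustar (us : R -> R) : is_step_ustar us ->
  threshold_functional p us =
    (2 * (2 * G 6 - 2 * G 5 + 2 * G 4 + 2 * G 3 - 4 * G 2))%:E.
Proof.
move=> hus.
(* The breakpoints are listed with both signs, as the exceptional set concerns [x] and not its
   absolute value. *)
have off x : x \notin [:: 1; 2; 3; 4; -1; -2; -3; -4] ->
    us x = layers ustar_left ustar_right x.
  move=> xs; apply: is_step_ustar_layers => //; apply: contra xs.
  rewrite !inE !eqr_norml ler01 !ler0n !andbT.
  by move=> /or4P[] /orP[] ->; rewrite ?orbT.
rewrite (threshold_functional_layers p0 dG nested_ustar _ _ _ _ _ off);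
  rewrite /ustar_left /ustar_right /escape_integral /=; [|lra..].
have -> : 4 - - 2 = 6 :> R by lra.
have -> : 4 - 2 = 2 :> R by lra.
have -> : 2 - - 4 = 6 :> R by lra.
have -> : - 2 - - 4 = 2 :> R by lra.
have -> : 3 - - 1 = 4 :> R by lra.
have -> : 3 - 1 = 2 :> R by lra.
have -> : 1 - - 3 = 4 :> R by lra.
have -> : - 1 - - 3 = 2 :> R by lra.
have -> : 4 - - 1 = 5 :> R by lra.
have -> : 4 - 1 = 3 :> R by lra.
have -> : 1 - - 4 = 5 :> R by lra.
have -> : - 1 - - 4 = 3 :> R by lra.
by congr EFin; lra.
Qed.

End step_functions.

Theorem proposition4p1 (R : realType) (u us : R -> R)
    (hu : is_step_u u) (hus : is_step_ustar us) :
  [/\ exists v : R -> R, symm_decr_rearr u v /\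
        (forall x, `|x| \notin [:: 1; 2; 3; 4] -> us x = v x),
      forall p : R, 1 < p ->
        let c := 2 / (p * (p - 1)) *
          (2 `^ (1 - p) - 2 * 3 `^ (1 - p) + 2 * 5 `^ (1 - p) - 6 `^ (1 - p)) in
        (threshold_functional p us - threshold_functional p u)%E = c%:E /\
        0 < c,
      (threshold_functional 1 us - threshold_functional 1 u)%E
        = (2 * ln (27 / 25))%:E /\
      0 < 2 * ln (27 / 25 : R)
    & [/\ threshold_functional 2 u = (5 / 6)%:E,
          threshold_functional 2 us = (9 / 10)%:E
        & (threshold_functional 2 us - threshold_functional 2 u)%E
          = (1 / 15)%:E]].
Proof.
have valueE (p : R) (p1 : 1 < p) (p0 := lt_trans ltr01 p1) :=
  (threshold_functional_u p0 (fun t => @is_derive_powR_primitive _ p t p1) hu,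
   threshold_functional_ustar p0
     (fun t => @is_derive_powR_primitive _ p t p1) hus).
split.
- exists (layers (@ustar_left R) (@ustar_right R)).
  split; first exact: symm_decr_rearr_layers.
  by move=> x; exact: is_step_ustar_layers.
- move=> p p1 c; split.
    by rewrite !(valueE _ p1) -EFinB /c; congr EFin; ring.
  rewrite /c mulr_gt0//; first by rewrite divr_gt0// mulr_gt0; lra.
  have q0 : 0 < p - 1 by lra.
  by have := powRN_alternating_gt0 q0; rewrite opprB.
- split.
    rewrite (threshold_functional_u ltr01 (@is_derive_ln_primitive R) hu).
    rewrite (threshold_functional_ustar ltr01 (@is_derive_ln_primitive R) hus).
    rewrite -EFinB; congr EFin.
    (* All logarithms are expressed through those of 2, 3 and 5. *)
    have lnE (n k : nat) : (0 < n)%N -> ln ((n ^ k)%N%:R : R) = k%:R * ln n%:R.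
      by move=> n0; rewrite natrX lnXn ?ltr0n// mulr_natl.
    have ln27 := lnE 3 3 isT; have ln25 := lnE 5 2 isT.
    have ln4 := lnE 2 2 isT.
    have -> : ln (6 : R) = ln 2 + ln 3.
      by rewrite -lnM ?posrE ?ltr0n// -natrM.
    by rewrite ln_div ?posrE ?ltr0n// ln27 ln25 ln4; lra.
  by rewrite mulr_gt0// ln_gt0//; lra.
(* At p = 2 the primitive is - 1 / (2 t), so the values are rational. *)
- have powE (t : R) : 0 < t -> t `^ (1 - 2) = t^-1.
    by move=> t0; rewrite (_ : 1 - 2 = -1) ?powR_inv1 ?ltW//; ring.
  have lt12 : 1 < 2 :> R by lra.
  by rewrite !(valueE _ lt12) !powE// -?EFinB; split; congr EFin; field.
Qed.
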